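(* Let $0\le r\le 1$ and $y=\frac{\sqrt3}{6}$. For every algorithm $\mathcal A$ evacuating two agents of transmission range $r$ initially positioned at the centroid of an equilateral triangle with sides of length $1$, the worst-case evacuation time satisfies $$E_{\mathcal A}(2,r)\ \ge\ \max\{\,1.5+y,\ 1+4y-r\,\}.$$
   Context: A single exit lies at a point of the perimeter of the triangle, unknown to the agents. Both agents start at the centroid at time $0$ and can move at speed at most $1$. An agent recognizes the exit only when it is at the exit's location. The two agents can exchange information (instantly) exactly when their distance is at most $r$. An algorithm assigns (deterministically) to each agent a predetermined trajectory, which the agent may leave only after it has found the exit or been notified by the other agent of the location of the exit, and specifies its actions in those cases; in particular an agent's motion depends on the exit's location only through what it has itself found or been told. The evacuation time for a given exit location is the first time by which both agents have reached the exit. $E_{\mathcal A}(2,r)$ is the supremum of the evacuation time over all exit locations on the perimeter. *)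

(* Defs.v *)
From mathcomp Require Import all_boot all_order all_algebra.
From mathcomp Require Import all_classical all_reals all_analysis.

Set Implicit Arguments.
Unset Strict Implicit.
Unset Printing Implicit Defensive.

Import Order.TTheory GRing.Theory Num.Theory.

Local Open Scope classical_set_scope.
Local Open Scope ring_scope.

(* The norm MathComp-Analysis puts on 'rV[R]_2 is the sup norm, so the
   Euclidean distance is defined here. *)
Definition edist (R : realType) (p q : 'rV[R]_2) : R :=
  Num.sqrt (\sum_(i < 2) (p 0 i - q 0 i) ^+ 2).

Definition equilateral_unit (R : realType) (A B C : 'rV[R]_2) : Prop :=
  [/\ edist A B = 1, edist B C = 1 & edist C A = 1].

Definition centroid (R : realType) (A B C : 'rV[R]_2) : 'rV[R]_2 :=
  3^-1 *: (A + B + C).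

Definition side (R : realType) (p q : 'rV[R]_2) : set 'rV[R]_2 :=
  [set x | exists2 t : R, 0 <= t <= 1 & x = (1 - t) *: p + t *: q].

Definition perimeter (R : realType) (A B C : 'rV[R]_2) : set 'rV[R]_2 :=
  side A B `|` side B C `|` side C A.

(* Trajectories are functions of time; only times t >= 0 matter. *)
Definition speed_le1 (R : realType) (f : R -> 'rV[R]_2) : Prop :=
  forall s t : R, 0 <= s -> s <= t -> edist (f s) (f t) <= t - s.

Definition visited (R : realType) (f : R -> 'rV[R]_2) (x : 'rV[R]_2) (t : R)
    : Prop :=
  exists2 s : R, 0 <= s <= t & f s = x.

(* The two agents are the booleans; the agent other than i is ~~ i.
   [informed r e pos i t]: by time t, agent i either has been at the exit e
   itself, or has been within distance r of the other agent at a moment when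
   that agent had already been at e.  With two agents, an agent that was told
   about e was told by the one that found it, so no further relaying of the
   information has to be considered. *)
Definition informed (R : realType) (r : R) (e : 'rV[R]_2)
    (pos : bool -> R -> 'rV[R]_2) (i : bool) (t : R) : Prop :=
  visited (pos i) e t \/
  exists2 s : R, 0 <= s <= t &
    visited (pos (~~ i)) e s /\ edist (pos i s) (pos (~~ i) s) <= r.

(* [plan i] is the predetermined trajectory of agent i, and [run e i] is its
   actual trajectory when the exit is at e.  The run must follow the plan up to
   the moment at which the agent is informed.  From then on the agent knows e,
   and hence, everything being deterministic, the whole situation; so the
   actions specified by the algorithm amount to an arbitrary continuation of
   speed at most 1 depending on e. *)
Record algorithm (R : realType) (A B C : 'rV[R]_2) (r : R) := Algorithm {
  plan : bool -> R -> 'rV[R]_2;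
  run : 'rV[R]_2 -> bool -> R -> 'rV[R]_2;
  plan_start : forall i, plan i 0 = centroid A B C;
  plan_speed : forall i, speed_le1 (plan i);
  run_start : forall e i, perimeter A B C e -> run e i 0 = centroid A B C;
  run_speed : forall e i, perimeter A B C e -> speed_le1 (run e i);
  run_plan : forall e i t, perimeter A B C e -> 0 <= t ->
    (forall s, 0 <= s < t -> ~ informed r e (run e) i s) ->
    run e i t = plan i t
}.

(* The first time by which both agents have reached e; it is +oo if some agent
   never does. *)
Definition evacuation_time (R : realType) (A B C : 'rV[R]_2) (r : R)
    (alg : algorithm A B C r) (e : 'rV[R]_2) : \bar R :=
  ereal_inf [set t%:E | t in
    [set t : R | 0 <= t /\ forall i, visited (run alg e i) e t]].

Definition worst_case_time (R : realType) (A B C : 'rV[R]_2) (r : R)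
    (alg : algorithm A B C r) : \bar R :=
  ereal_sup [set evacuation_time alg e | e in perimeter A B C].

(* Main.v *)
Require Import Defs.
From mathcomp Require Import all_boot all_order all_algebra.
From mathcomp Require Import all_classical all_reals all_analysis.
From mathcomp Require Import ring lra zify.

(** An agent leaves its plan only once it is informed, so an algorithm matters
    only through the first time [tau p] at which one of the two plans reaches
    the perimeter point [p], and through the agent [ag p] that reaches it.  If
    all evacuation times are at most [T], then for perimeter points [p], [q]:
    the times of two points visited by the same agent differ by at least
    [|pq|]; if [p] is visited first, its visitor cannot know about [q] yet,
    hence [tau p + |pq| <= T]; and in any case the visitor of [p] either still
    has to travel to [q], or has received news that left [q] at time [tau q],
    moved at speed 1 and jumped over a distance [r] once, so that
    [tau q + |pq| - r <= tau p].

    For the first bound, subdivide each side into [m] parts: the [3m] division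
    points lie on a triangular lattice, hence are pairwise at distance at least
    [1/m], and no point of the perimeter is reached before time [y].  So an
    agent alone visits at most [(T - y) m + 1] of them; let [m] grow.

    For the second bound, suppose [T < 1 + 4y - r] and let [A] be the last
    visited vertex.  Some agent visits two vertices, so [tau A >= 1 + 2y].  As
    points of [BC] are at distance at least [3y] from [A], they are all visited
    before time [1 + y].  The same deadline holds for the points of [AB] at
    distance at most [tau C - y] from [B], because news from [C] would arrive
    there too late, and symmetrically for the points of [CA] at distance at
    most [tau B - y] from [C].  Since [B] and [C] are visited by different
    agents, a few well chosen points among these are already too many. *)

Set Implicit Arguments.
Unset Strict Implicit.
Unset Printing Implicit Defensive.

Import Order.TTheory GRing.Theory Num.Theory.
(* MathComp-Analysis has another [edist]. *)
Import Defs.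

Local Open Scope ring_scope.

(** * Euclidean distance in the plane *)

Section Euclidean.
Variable R : realType.
Implicit Types p q s : 'rV[R]_2.

Lemma edistE p q :
  edist p q = Num.sqrt ((p 0 0 - q 0 0) ^+ 2 + (p 0 1 - q 0 1) ^+ 2).
Proof.
rewrite /edist !big_ord_recl big_ord0 addr0 (_ : lift ord0 ord0 = 1) //.
exact/val_inj.
Qed.

Lemma edist_ge0 p q : 0 <= edist p q.
Proof. exact: sqrtr_ge0. Qed.

Lemma edistC p q : edist p q = edist q p.
Proof. by rewrite !edistE; congr Num.sqrt; ring. Qed.

Lemma edistxx p : edist p p = 0.
Proof. by rewrite edistE !subrr expr0n addr0 sqrtr0. Qed.

Lemma edist0_eq p q : edist p q = 0 -> p = q.
Proof.
rewrite edistE => /eqP; rewrite sqrtr_eq0 => h.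
apply/rowP => i; apply/eqP; rewrite -subr_eq0 -sqrf_eq0.
have h0 := sqr_ge0 (p 0 0 - q 0 0); have h1 := sqr_ge0 (p 0 1 - q 0 1).
have [->|->] : i = 0 \/ i = 1.
  by case: i => [[|[|//]] hi]; [left|right]; apply: val_inj.
- by apply/eqP; lra.
- by apply/eqP; lra.
Qed.

Lemma edist_triangle p q s : edist p s <= edist p q + edist q s.
Proof.
rewrite !edistE.
set a := p 0 0 - q 0 0; set b := p 0 1 - q 0 1.
set c := q 0 0 - s 0 0; set d := q 0 1 - s 0 1.
have -> : p 0 0 - s 0 0 = a + c by rewrite /a /c; ring.
have -> : p 0 1 - s 0 1 = b + d by rewrite /b /d; ring.
have hx : 0 <= a ^+ 2 + b ^+ 2 by rewrite addr_ge0 ?sqr_ge0.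
have hy : 0 <= c ^+ 2 + d ^+ 2 by rewrite addr_ge0 ?sqr_ge0.
have hcs : a * c + b * d <=
    Num.sqrt (a ^+ 2 + b ^+ 2) * Num.sqrt (c ^+ 2 + d ^+ 2).
  rewrite -sqrtrM // (le_trans (ler_norm _)) // -sqrtr_sqr ler_wsqrtr //.
  rewrite -subr_ge0.
  suff -> : (a ^+ 2 + b ^+ 2) * (c ^+ 2 + d ^+ 2) - (a * c + b * d) ^+ 2 =
     (a * d - b * c) ^+ 2 by apply: sqr_ge0.
  ring.
rewrite -[leRHS]ger0_norm ?addr_ge0 ?sqrtr_ge0 // -sqrtr_sqr ler_wsqrtr //.
rewrite [leRHS]sqrrD !sqr_sqrtr //.
lra.
Qed.

End Euclidean.

(** * First visits *)

Section FirstVisits.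
Variable R : realType.
Implicit Types (e : 'rV[R]_2) (s t : R) (i j : bool).

(** The infimum of the visiting times is attained: otherwise each agent is then at positive distance
    from [e], and the speed limit leaves a gap above the infimum. *)
Lemma first_visit (pos : bool -> R -> 'rV[R]_2) e i0 s0 :
  (forall i, speed_le1 (pos i)) -> 0 <= s0 -> pos i0 s0 = e ->
  exists t i, [/\ 0 <= t <= s0, pos i t = e &
    forall j s, 0 <= s < t -> pos j s <> e].
Proof.
move=> hpos s0_ge0 hs0.
pose S := [set s | 0 <= s /\ exists i, pos i s = e]%classic.
have S_s0 : S s0 by split=> //; exists i0.
have lbS : has_lbound S by exists 0 => s [].
have infS : has_inf S by split=> //; exists s0.
have inf_ge0 : 0 <= inf S by apply: lb_le_inf => [|s []//]; exists s0.
have near i d : 0 < d -> d <= edist (pos i (inf S)) e ->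
    forall s, S s -> s < inf S + d -> pos i s <> e.
  move=> d_gt0 hd s Ss hs hi; have hle : inf S <= s by exact: ge_inf.
  have := hpos i _ _ inf_ge0 hle; rewrite hi; lra.
have [i hi] : exists i, pos i (inf S) = e.
  apply: contrapT => hno.
  have pos_gt0 i : 0 < edist (pos i (inf S)) e.
    rewrite lt_neqAle edist_ge0 andbT eq_sym; apply/eqP => /edist0_eq h.
    by apply: hno; exists i.
  pose d := Num.min (edist (pos true (inf S)) e) (edist (pos false (inf S)) e).
  have d_gt0 : 0 < d by rewrite lt_min !pos_gt0.
  have [s Ss hs] := inf_adherent d_gt0 infS.
  case: (Ss) => _ [i]; apply: near Ss hs => //.
  by rewrite /d ge_min; case: i; rewrite lexx ?orbT.
exists (inf S), i; split=> //; first by rewrite inf_ge0; exact: ge_inf.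
move=> j s /andP[s_ge0 hs] hj.
suff : inf S <= s by rewrite leNgt hs.
by apply: ge_inf => //; split=> //; exists j.
Qed.

Variables (A B C : 'rV[R]_2) (r T : R) (alg : algorithm A B C r).

(** Nobody is informed strictly before the first visit, so the runs agree with the plans up to and
    including [tau]. *)
Lemma first_visit_run e t0 : perimeter A B C e -> 0 <= t0 <= T ->
  (forall i, visited (run alg e i) e t0) ->
  exists tau i, [/\ 0 <= tau <= T, plan alg i tau = e,
    forall j s, 0 <= s < tau -> run alg e j s <> e &
    forall j s, 0 <= s <= tau -> run alg e j s = plan alg j s].
Proof.
move=> pe /andP[_ t0T] vis; have [s0 /andP[s0_ge0 s0t0] hs0] := vis true.
have [tau [i [/andP[tau_ge0 tau_s0] htau first]]] :=
  first_visit (fun i => run_speed alg i pe) s0_ge0 hs0.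
have agree j s : 0 <= s <= tau -> run alg e j s = plan alg j s.
  move=> /andP[s_ge0 s_tau]; apply: run_plan => // s' /andP[s'_ge0 s's].
  have novis k u : u < tau -> ~ visited (run alg e k) e u.
    move=> u_tau [v /andP[v_ge0 vu]] hv; apply: (first k v) hv.
    by rewrite v_ge0 (le_lt_trans vu).
  have s'_tau := lt_le_trans s's s_tau.
  case=> [/novis|[u /andP[_ us'] [/novis h _]]]; first exact.
  exact/h/(le_lt_trans us').
exists tau, i; split=> //.
  by rewrite tau_ge0 (le_trans tau_s0) // (le_trans s0t0).
by rewrite -agree // tau_ge0 lexx.
Qed.

Variables (e : 'rV[R]_2) (t0 tau : R).
Hypothesis r_ge0 : 0 <= r.
Hypothesis pe : perimeter A B C e.
Hypothesis t0T : 0 <= t0 <= T.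
Hypothesis vis : forall i, visited (run alg e i) e t0.
Hypothesis tau_first : forall j s, 0 <= s < tau -> run alg e j s <> e.
Hypothesis tau_agree :
  forall j s, 0 <= s <= tau -> run alg e j s = plan alg j s.

Lemma unvisited_cost j t : 0 <= t <= tau -> t + edist (plan alg j t) e <= T.
Proof.
move=> /andP[t_ge0 t_tau]; have [s /andP[s_ge0 st0] hs] := vis j.
have ts : t <= s.
  rewrite leNgt; apply/negP => st; apply: (tau_first _ hs).
  by rewrite s_ge0 (lt_le_trans st).
rewrite -tau_agree ?t_ge0 //.
have := run_speed alg j pe t_ge0 ts; rewrite hs; move/andP: t0T => [_]; lra.
Qed.

(* The second alternative is stated at the first moment [inf S] at which agent
   [j] is informed: until then it follows its plan, and by then the news, which
   left [e] no earlier than [tau], is within [r] of it. *)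
Lemma uninformed_cost j t : 0 <= t ->
  t + edist (plan alg j t) e <= T \/ tau + edist (plan alg j t) e - r <= t.
Proof.
move=> t_ge0.
have [[s1 [/andP[s1_ge0 s1t] inf1]]|noinf] := pselect
    (exists s, 0 <= s < t /\ informed r e (run alg e) j s); last first.
  have rp : run alg e j t = plan alg j t.
    by apply: run_plan => // s hs inf; apply: noinf; exists s.
  left; have [s /andP[s_ge0 st0] hs] := vis j.
  have ts : t <= s.
    rewrite leNgt; apply/negP => st; apply: noinf; exists s.
    rewrite s_ge0 st; split=> //; left; exists s => //.
    by rewrite s_ge0 lexx.
  rewrite -rp; have := run_speed alg j pe t_ge0 ts; rewrite hs.
  by move/andP: t0T => [_]; lra.
right.
pose S := [set s | 0 <= s /\ informed r e (run alg e) j s]%classic.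
have S_s1 : S s1 by [].
have lbS : has_lbound S by exists 0 => s [].
have infS : has_inf S by split=> //; exists s1.
have inf_ge0 : 0 <= inf S by apply: lb_le_inf => [|s []//]; exists s1.
have inf_t : inf S <= t by rewrite (le_trans _ (ltW s1t)) //; exact: ge_inf.
have rp : run alg e j (inf S) = plan alg j (inf S).
  apply: run_plan => // s /andP[s_ge0 sS] infs.
  by move: sS; rewrite ltNge => /negP; apply; apply: ge_inf.
have tau_le k s : 0 <= s -> run alg e k s = e -> tau <= s.
  move=> s_ge0 hs; rewrite leNgt; apply/negP => h.
  by apply: (tau_first _ hs); rewrite s_ge0.
have witness s : S s -> exists s0,
    [/\ S s0, s0 <= s & edist (run alg e j s0) e <= r + (s0 - tau)].
  move=> [s_ge0 [[s0 /andP[s0_ge0 s0s] hs0]|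
      [s0 /andP[s0_ge0 s0s] [[s' /andP[s'_ge0 s's0] hs'] hr]]]].
    exists s0; split=> //.
      by split=> //; left; exists s0; rewrite // s0_ge0 lexx.
    rewrite hs0 edistxx; have := tau_le _ _ s0_ge0 hs0; have := r_ge0; lra.
  exists s0; split=> //.
    split=> //; right; exists s0; first by rewrite s0_ge0 lexx.
    by split=> //; exists s'; rewrite ?s'_ge0.
  have := edist_triangle (run alg e j s0) (run alg e (~~ j) s0) e.
  have := run_speed alg (~~ j) pe s'_ge0 s's0; rewrite hs' edistC.
  by have := tau_le _ _ s'_ge0 hs'; lra.
apply/ler_addgt0Pr => d d_gt0.
(* The error [s0 - inf S] enters twice: in the motion of [j] after [inf S] and in the age of the
   news. *)
have d2_gt0 : 0 < d / 2 by lra.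
have [s Ss hs] := inf_adherent d2_gt0 infS.
have [s0 [Ss0 s0s hs0]] := witness _ Ss.
have inf_s0 : inf S <= s0 by exact: ge_inf.
have h1 := plan_speed alg j inf_ge0 inf_t.
have h2 := run_speed alg j pe inf_ge0 inf_s0.
have h3 := edist_triangle (plan alg j t) (plan alg j (inf S)) e.
have h4 := edist_triangle (run alg e j (inf S)) (run alg e j s0) e.
rewrite rp in h2 h4; rewrite edistC in h1; lra.
Qed.

End FirstVisits.

(* The constraints of the header; [tau p] and [ag p] stand for the time and the
   agent of the first visit of [p] by the plans. *)
Definition schedule (R : realType) (A B C : 'rV[R]_2) (r T : R)
    (tau : 'rV[R]_2 -> R) (ag : 'rV[R]_2 -> bool) : Prop :=
  [/\ forall p, perimeter A B C p -> edist (centroid A B C) p <= tau p,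
    forall p q, perimeter A B C p -> perimeter A B C q -> ag p = ag q ->
      tau p + edist p q <= tau q \/ tau q + edist p q <= tau p,
    forall p q, perimeter A B C p -> perimeter A B C q -> tau p <= tau q ->
      tau p + edist p q <= T
  & forall p q, perimeter A B C p -> perimeter A B C q ->
      tau p + edist p q <= T \/ tau q + edist p q - r <= tau p].

Lemma schedule_of_algorithm (R : realType) (A B C : 'rV[R]_2) (r T : R)
    (alg : algorithm A B C r) : 0 <= r ->
  (forall e, perimeter A B C e -> exists2 t, 0 <= t <= T &
     forall i, visited (run alg e i) e t) ->
  exists tau ag, schedule A B C r T tau ag.
Proof.
move=> r_ge0 evac.
pose good e (x : R * bool) := perimeter A B C e -> exists t0,
  [/\ 0 <= t0 <= T, forall i, visited (run alg e i) e t0,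
      0 <= x.1 /\ plan alg x.2 x.1 = e,
      forall j s, 0 <= s < x.1 -> run alg e j s <> e &
      forall j s, 0 <= s <= x.1 -> run alg e j s = plan alg j s].
have /choice[f fP] : forall e, exists x, good e x.
  move=> e; have [pe|npe] := pselect (perimeter A B C e); last by exists (0, true).
  have [t0 t0T vis] := evac e pe.
  have [tau [i [/andP[tau_ge0 _] hi first agree]]] := first_visit_run pe t0T vis.
  by exists (tau, i) => _; exists t0.
exists (fst \o f), (snd \o f); split=> /=.
- move=> p pp; have [_ [_ _ [tau_ge0 hp] _ _]] := fP p pp.
  by have := plan_speed alg (f p).2 (lexx 0) tau_ge0; rewrite plan_start hp subr0.
- move=> p q pp pq hag; have [_ [_ _ [p_ge0 hp] _ _]] := fP p pp.
  have [_ [_ _ [q_ge0 hq] _ _]] := fP q pq.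
  have [h|h] := leP (f p).1 (f q).1.
    left; have := plan_speed alg (f p).2 p_ge0 h; rewrite hp hag hq; lra.
  right; have := plan_speed alg (f p).2 q_ge0 (ltW h).
  by rewrite hp hag hq edistC; lra.
- move=> p q pp pq hpq; have [_ [_ _ [p_ge0 hp] _ _]] := fP p pp.
  have [t0 [t0T vis _ first agree]] := fP q pq.
  have := unvisited_cost pq t0T vis first agree (f p).2 (t := (f p).1).
  by rewrite p_ge0 hpq hp; apply.
- move=> p q pp pq; have [_ [_ _ [p_ge0 hp] _ _]] := fP p pp.
  have [t0 [t0T vis _ first agree]] := fP q pq.
  by have := uninformed_cost r_ge0 pq t0T vis first (f p).2 p_ge0; rewrite hp.
Qed.

(** * Relabelling the vertices *)

Section Symmetry.
Variables (R : realType) (A B C : 'rV[R]_2).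

Lemma side_sym (p q : 'rV[R]_2) : side p q = side q p.
Proof.
by apply/seteqP; split=> _ [t ht ->]; (exists (1 - t); [lra | rewrite addrC subKr]).
Qed.

Lemma perimeter_rot : perimeter A B C = perimeter B C A.
Proof. by rewrite /perimeter -setUA setUC. Qed.

Lemma perimeter_swap : perimeter A B C = perimeter A C B.
Proof.
by rewrite /perimeter (side_sym A B) (side_sym B C) (side_sym C A)
  -[RHS]setUA [RHS]setUC (setUC (side C B)).
Qed.

Lemma centroid_rot : centroid A B C = centroid B C A.
Proof. by rewrite /centroid [in RHS]addrC addrA. Qed.

Lemma centroid_swap : centroid A B C = centroid A C B.
Proof. by rewrite /centroid addrAC. Qed.

Lemma equilateral_rot : equilateral_unit A B C -> equilateral_unit B C A.
Proof. by case. Qed.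

Lemma equilateral_swap : equilateral_unit A B C -> equilateral_unit A C B.
Proof. by case=> *; split; rewrite edistC. Qed.

Variables (r T : R) (tau : 'rV[R]_2 -> R) (ag : 'rV[R]_2 -> bool).

Lemma schedule_rot : schedule A B C r T tau ag -> schedule B C A r T tau ag.
Proof. by rewrite /schedule perimeter_rot centroid_rot. Qed.

Lemma schedule_swap : schedule A B C r T tau ag -> schedule A C B r T tau ag.
Proof. by rewrite /schedule perimeter_swap centroid_swap. Qed.

End Symmetry.

(** * Affine coordinates in the triangle *)

Section Coordinates.
Variable R : realType.
Implicit Types A B C : 'rV[R]_2.

Definition affine_point A B C (a b : R) : 'rV[R]_2 :=
  A + a *: (B - A) + b *: (C - A).

(** The three unit sides determine, by polarization, the inner product [1 / 2] of [B - A] and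
    [C - A]. *)
Lemma edist_affine A B C (a b a' b' : R) : equilateral_unit A B C ->
  edist (affine_point A B C a b) (affine_point A B C a' b') =
  Num.sqrt ((a - a') ^+ 2 + (a - a') * (b - b') + (b - b') ^+ 2).
Proof.
have sq1 p q : edist p q = 1 ->
    (p 0 0 - q 0 0) ^+ 2 + (p 0 1 - q 0 1) ^+ 2 = 1 :> R.
  move=> h; rewrite -[RHS](expr1n _ 2) -h edistE sqr_sqrtr //.
  by rewrite addr_ge0 ?sqr_ge0.
case=> /sq1 hAB /sq1 hBC /sq1 hCA; rewrite edistE; congr Num.sqrt.
rewrite /affine_point !mxE.
set a0 := A 0 0 in hAB hCA *; set a1 := A 0 1 in hAB hCA *.
set b0 := B 0 0 in hAB hBC *; set b1 := B 0 1 in hAB hBC *.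
set c0 := C 0 0 in hBC hCA *; set c1 := C 0 1 in hBC hCA *.
set u := a - a'; set v := b - b'.
transitivity (u ^+ 2 * ((a0 - b0) ^+ 2 + (a1 - b1) ^+ 2)
  + u * v * (((a0 - b0) ^+ 2 + (a1 - b1) ^+ 2)
    + ((c0 - a0) ^+ 2 + (c1 - a1) ^+ 2) - ((b0 - c0) ^+ 2 + (b1 - c1) ^+ 2))
  + v ^+ 2 * ((c0 - a0) ^+ 2 + (c1 - a1) ^+ 2)); last first.
  by rewrite hAB hBC hCA; ring.
by rewrite /u /v; ring.
Qed.

Lemma le_edist_affine A B C (k a b a' b' : R) : equilateral_unit A B C ->
  k ^+ 2 <= (a - a') ^+ 2 + (a - a') * (b - b') + (b - b') ^+ 2 ->
  k <= edist (affine_point A B C a b) (affine_point A B C a' b').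
Proof.
move=> hABC hk; rewrite edist_affine // (le_trans (ler_norm _)) //.
by rewrite -sqrtr_sqr ler_wsqrtr.
Qed.

Lemma affine_A A B C : affine_point A B C 0 0 = A.
Proof. by rewrite /affine_point !scale0r !addr0. Qed.

Lemma affine_B A B C : affine_point A B C 1 0 = B.
Proof. by rewrite /affine_point scale0r scale1r addr0 addrC subrK. Qed.

Lemma affine_C A B C : affine_point A B C 0 1 = C.
Proof. by rewrite /affine_point scale0r scale1r addr0 addrC subrK. Qed.

Lemma affine_centroid A B C :
  affine_point A B C (1 / 3) (1 / 3) = centroid A B C.
Proof.
by apply/rowP => i; rewrite /affine_point /centroid !mxE; field.
Qed.

Lemma affine_swap A B C (a b : R) :
  affine_point A B C a b = affine_point A C B b a.
Proof. by rewrite /affine_point addrAC. Qed.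

Lemma perimeter_AB A B C (a : R) : 0 <= a <= 1 ->
  perimeter A B C (affine_point A B C a 0).
Proof.
move=> ha; left; left; exists a => //.
by apply/rowP => i; rewrite /affine_point !mxE; ring.
Qed.

Lemma perimeter_CA A B C (b : R) : 0 <= b <= 1 ->
  perimeter A B C (affine_point A B C 0 b).
Proof.
move=> hb; right; exists (1 - b); first lra.
by apply/rowP => i; rewrite /affine_point !mxE; ring.
Qed.

Lemma perimeter_BC A B C (b : R) : 0 <= b <= 1 ->
  perimeter A B C (affine_point A B C (1 - b) b).
Proof.
move=> hb; left; right; exists b => //.
by apply/rowP => i; rewrite /affine_point !mxE; ring.
Qed.

End Coordinates.

(** * Counting division points *)

Section Inradius.
Variable R : realType.

Definition inradius : R := Num.sqrt 3 / 6.

Lemma inradius_sq : inradius ^+ 2 = 1 / 12.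
Proof. by rewrite /inradius expr_div_n sqr_sqrtr //; field. Qed.

Lemma inradius_bounds : 2 / 7 < inradius < 7 / 24.
Proof.
have h := inradius_sq.
have h0 : 0 <= inradius by rewrite divr_ge0 // sqrtr_ge0.
by apply/andP; split; rewrite -ltr_sqr ?nnegrE; lra.
Qed.

Lemma inradius_le_start (A B C : 'rV[R]_2) (r T : R) tau ag :
  equilateral_unit A B C -> schedule A B C r T tau ag ->
  forall p, perimeter A B C p -> inradius <= tau p.
Proof.
move=> hABC [start _ _ _] p pp; apply: le_trans (start p pp).
have h := inradius_sq.
rewrite -(affine_centroid A B C).
case: pp => [[|]|] [t _ ->].
- have -> : (1 - t) *: A + t *: B = affine_point A B C t 0.
    by apply/rowP => i; rewrite /affine_point !mxE; ring.
  by apply: le_edist_affine => //; have := sqr_ge0 (t - 1 / 2); nra.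
- have -> : (1 - t) *: B + t *: C = affine_point A B C (1 - t) t.
    by apply/rowP => i; rewrite /affine_point !mxE; ring.
  by apply: le_edist_affine => //; have := sqr_ge0 (t - 1 / 2); nra.
- have -> : (1 - t) *: C + t *: A = affine_point A B C 0 (1 - t).
    by apply/rowP => i; rewrite /affine_point !mxE; ring.
  by apply: le_edist_affine => //; have := sqr_ge0 (t - 1 / 2); nra.
Qed.

End Inradius.

Section PerimeterBound.

(* The division point number [x.2] of the side number [x.1], in the basis
   [((B - A) / m, (C - A) / m)] with origin [A]. *)
Definition lattice_coord (m : nat) (x : 'I_3 * 'I_m) : int * int :=
  if val x.1 == 0 then (Posz x.2, 0)
  else if val x.1 == 1 then (Posz m - Posz x.2, Posz x.2)
  else (0, Posz m - Posz x.2).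

(** Each side omits its end point, which is the first point of the next side, so no vertex is
    counted twice. *)
Lemma lattice_coord_inj m : injective (@lattice_coord m).
Proof.
move=> [[i hi] [j hj]] [[i' hi'] [j' hj']]; rewrite /lattice_coord /= => h.
suff [ei ej] : i = i' /\ j = j'.
  by subst i' j'; congr (_, _); apply: val_inj.
by move: i i' hi hi' h => [|[|[|//]]] [|[|[|//]]] _ _ /= [] *; lia.
Qed.

Variables (R : realType) (A B C : 'rV[R]_2).

Definition lattice_point (m : nat) (x : 'I_3 * 'I_m) : 'rV[R]_2 :=
  affine_point A B C ((lattice_coord x).1%:~R / m%:R)
                     ((lattice_coord x).2%:~R / m%:R).

Lemma lattice_point_perimeter m (x : 'I_3 * 'I_m) :
  perimeter A B C (lattice_point x).
Proof.
have m_gt0 : (0 < m%:R :> R).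
  by rewrite ltr0n; case: x => _ [j]; apply: leq_ltn_trans.
have hj : 0 <= (x.2%:R / m%:R : R) <= 1.
  by rewrite divr_ge0 //= ler_pdivrMr // mul1r ler_nat ltnW.
have hsub : (Posz m - Posz x.2)%:~R / m%:R = 1 - x.2%:R / m%:R :> R.
  by rewrite intrB -!pmulrn mulrBl divff // gt_eqF.
rewrite /lattice_point /lattice_coord; case: ifP => _ /=; last case: ifP => _ /=.
- by rewrite mul0r -pmulrn; apply: perimeter_AB.
- by rewrite hsub -pmulrn; apply: perimeter_BC.
- by rewrite hsub mul0r; apply: perimeter_CA; lra.
Qed.

(** The squared distance is [m ^- 2] times a positive definite form with integer values, hence at
    least 1 off the origin. *)
Lemma lattice_point_dist m (x x' : 'I_3 * 'I_m) : equilateral_unit A B C ->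
  x != x' -> 1 <= edist (lattice_point x) (lattice_point x') * m%:R.
Proof.
move=> hABC hne.
have m_gt0 : (0 < m%:R :> R).
  by rewrite ltr0n; case: x {hne} => _ [j]; apply: leq_ltn_trans.
rewrite -ler_pdivrMr //; apply: le_edist_affine => //.
move: hne; rewrite -(inj_eq (@lattice_coord_inj m)).
case: (lattice_coord x) (lattice_coord x') => [a b] [a' b'] hne /=.
rewrite -!mulrBl -!intrB.
set u := a - a'; set v := b - b'.
have -> : (u%:~R / m%:R) ^+ 2 + u%:~R / m%:R * (v%:~R / m%:R) + (v%:~R / m%:R) ^+ 2
    = (u ^+ 2 + u * v + v ^+ 2)%:~R * m%:R^-1 ^+ 2 :> R.
  by rewrite !(rmorphXn, rmorphM, rmorphD) /=; ring.
rewrite expr_div_n expr1n -exprVn ler_wpM2r ?sqr_ge0 // -[1]/(1%:~R) ler_int.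
have {}hne : u != 0 \/ v != 0.
  move: hne; rewrite xpair_eqE negb_and !subr_eq0 => /orP[]; first by left.
  by right.
suff : 0 < 2 * (u ^+ 2 + u * v + v ^+ 2) by lia.
have -> : 2 * (u ^+ 2 + u * v + v ^+ 2) = u ^+ 2 + v ^+ 2 + (u + v) ^+ 2 by ring.
rewrite ltr_wpDr ?sqr_ge0 //; case: hne => h.
  by rewrite ltr_wpDr ?sqr_ge0 // exprn_even_gt0.
by rewrite ltr_wpDl ?sqr_ge0 // exprn_even_gt0.
Qed.

Lemma perimeter_bound (r T : R) tau ag : equilateral_unit A B C ->
  schedule A B C r T tau ag -> 3 / 2 + inradius R <= T.
Proof.
move=> hABC sched; rewrite leNgt; apply/negP => hT.
have [_ speed cost _] := sched.
set d := 3 / 2 + inradius R - T; have d_gt0 : 0 < d by rewrite /d; lra.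
(* Here [m = 2n + 2 > 1 / d] and [k = 3m / 2 - 1], so the scaled times, at most [(3 / 2 - d) m],
   stay below [k], while [2k < 3m] leaves too few slots. *)
pose n := Num.truncn d^-1; pose m := n.*2.+2; pose k := (3 * n).+2.
have m_gt0 : (0 < m%:R :> R) by rewrite ltr0n.
have hdm : 1 < d * m%:R.
  rewrite mulrC -ltr_pdivrMr // div1r (lt_trans (truncnS_gt _)) // ltr_nat /m.
  by rewrite ltnS -/n -addnn; lia.
pose sc (x : 'I_3 * 'I_m) : R := (tau (lattice_point x) - inradius R) * m%:R.
have sc_ge0 x : 0 <= sc x.
  rewrite mulr_ge0 // subr_ge0.
  exact: (inradius_le_start hABC sched) (lattice_point_perimeter x).
have sc_lt x : sc x < k%:R.
  have px := lattice_point_perimeter x.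
  have := cost _ _ px px (lexx _); rewrite edistxx addr0 => hx.
  have : sc x <= (3 / 2 - d) * m%:R by rewrite ler_wpM2r // /d; lra.
  move=> /le_lt_trans; apply.
  have -> : (m%:R = 2 * n%:R + 2 :> R) by rewrite /m -addn2 natrD -muln2 natrM mulrC.
  have -> : (k%:R = 3 * n%:R + 2 :> R) by rewrite /k -addn2 natrD natrM.
  move: hdm; rewrite /m -addn2 natrD -muln2 natrM; lra.
have slot_lt x : (Num.truncn (sc x) < k)%N.
  by rewrite -(ltr_nat R) (le_lt_trans _ (sc_lt x)) // truncn_le.
pose slot x : bool * 'I_k := (ag (lattice_point x), Ordinal (slot_lt x)).
suff slot_inj : injective slot.
  have := leq_card _ slot_inj; rewrite !card_prod !card_ord card_bool /m /k.
  by rewrite -muln2; lia.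
move=> x x' [hag hslot]; apply/eqP/negPn/negP => hne.
have hd := lattice_point_dist hABC hne.
have /andP[lo hi] := truncn_itv (sc_ge0 x).
have /andP[lo' hi'] := truncn_itv (sc_ge0 x').
rewrite -natr1 hslot in lo hi; rewrite -natr1 in hi'.
have := speed _ _ (lattice_point_perimeter x) (lattice_point_perimeter x') hag.
by case=> h; have := ler_wpM2r (ltW m_gt0) h; rewrite /sc in lo hi lo' hi'; lra.
Qed.

End PerimeterBound.

(** * The last visited vertex *)

Section VertexBound.
Variable R : realType.
Implicit Types (A B C : 'rV[R]_2) (r T : R).
Local Notation y := (inradius R).

Lemma start_sqr A B C r T tau ag (a b : R) : equilateral_unit A B C ->
  schedule A B C r T tau ag -> perimeter A B C (affine_point A B C a b) ->
  (a - 1 / 3) ^+ 2 + (a - 1 / 3) * (b - 1 / 3) + (b - 1 / 3) ^+ 2 <=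
    tau (affine_point A B C a b) ^+ 2.
Proof.
move=> hABC [start _ _ _] pp; have := start _ pp.
rewrite -(affine_centroid A B C) edistC edist_affine // => h.
set q := leLHS; have q_ge0 : 0 <= q.
  by rewrite /q; have := sqr_ge0 (a - 1 / 3); have := sqr_ge0 (b - 1 / 3);
     have := sqr_ge0 (a - 1 / 3 + (b - 1 / 3)); lra.
rewrite -(sqr_sqrtr q_ge0) ler_pXn2r // nnegrE ?sqrtr_ge0 //.
by rewrite (le_trans _ h) ?sqrtr_ge0.
Qed.

Lemma leg A B C r T tau ag (k a b a' b' : R) : equilateral_unit A B C ->
  schedule A B C r T tau ag ->
  perimeter A B C (affine_point A B C a b) ->
  perimeter A B C (affine_point A B C a' b') ->
  k ^+ 2 <= (a - a') ^+ 2 + (a - a') * (b - b') + (b - b') ^+ 2 ->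
  ag (affine_point A B C a b) = ag (affine_point A B C a' b') ->
  tau (affine_point A B C a b) + k <= tau (affine_point A B C a' b') \/
  tau (affine_point A B C a' b') + k <= tau (affine_point A B C a b).
Proof.
move=> hABC [_ speed _ _] pp pq hk hag.
have := le_edist_affine hABC hk.
by case: (speed _ _ pp pq hag) => h1 h2; [left|right]; lra.
Qed.

Lemma opposite_side_early A B C r T tau ag (t : R) : equilateral_unit A B C ->
  0 <= r -> schedule A B C r T tau ag -> 1 + 2 * y <= tau A ->
  T < 1 + 4 * y - r -> 0 <= t <= 1 ->
  tau (affine_point A B C (1 - t) t) < 1 + y - r.
Proof.
move=> hABC r_ge0 [_ _ cost _] hA hT ht.
have y2 := inradius_sq R; have /andP[ylo yhi] := inradius_bounds R.
have pZ := perimeter_BC A B C ht.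
have pA : perimeter A B C (affine_point A B C 0 0) by apply: perimeter_AB; lra.
have hd : 3 * y <= edist (affine_point A B C 0 0) (affine_point A B C (1 - t) t).
  by apply: le_edist_affine => //; have := sqr_ge0 (t - 1 / 2); lra.
rewrite -(affine_A A B C) in hA.
have [h|h] := leP (tau (affine_point A B C (1 - t) t))
  (tau (affine_point A B C 0 0)).
  by have := cost _ _ pZ pA h; rewrite edistC; lra.
by have := cost _ _ pA pZ (ltW h); lra.
Qed.

(** Let [N] be the point at distance [u] from [B]. The remaining trip to [A] costs [1 - u], so the
    bound on [u] gives [tau N < tau C + 3 * y - r], whereas [N] is at distance at least [3 * y] from
    [C]. *)
Lemma adjacent_side_early A B C r T tau ag (u : R) : equilateral_unit A B C ->
  0 <= r -> schedule A B C r T tau ag -> 1 + 2 * y <= tau A ->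
  T < 1 + 4 * y - r -> 0 <= u <= 1 -> u <= tau (affine_point A B C 0 1) - y ->
  tau (affine_point A B C (1 - u) 0) < 1 + y - r /\
  (ag (affine_point A B C (1 - u) 0) = ag (affine_point A B C 0 1) ->
   tau (affine_point A B C (1 - u) 0) + 3 * y <= tau (affine_point A B C 0 1)).
Proof.
move=> hABC r_ge0 [_ speed cost info] hA hT hu huc.
have y2 := inradius_sq R; have /andP[ylo yhi] := inradius_bounds R.
have pN : perimeter A B C (affine_point A B C (1 - u) 0).
  by apply: perimeter_AB; lra.
have pA : perimeter A B C (affine_point A B C 0 0) by apply: perimeter_AB; lra.
have pC : perimeter A B C (affine_point A B C 0 1) by apply: perimeter_CA; lra.
rewrite -(affine_A A B C) in hA.
have dAC : 1 <= edist (affine_point A B C 0 0) (affine_point A B C 0 1).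
  by apply: le_edist_affine => //; lra.
have dAN : 1 - u <= edist (affine_point A B C 0 0) (affine_point A B C (1 - u) 0).
  by apply: le_edist_affine => //; lra.
have dNC : 3 * y <= edist (affine_point A B C (1 - u) 0) (affine_point A B C 0 1).
  by apply: le_edist_affine => //; have := sqr_ge0 (u - 1 / 2); lra.
have hAC : tau (affine_point A B C 0 1) + 1 - r <= tau (affine_point A B C 0 0).
  by case: (info _ _ pA pC); lra.
(* If [A] came before [N], then [hAC] would give [T >= tau C + 2 - r - u], which is too large since
   [3 * y < 1]. *)
have hN : tau (affine_point A B C (1 - u) 0) + (1 - u) <= T.
  have [h|h] := leP (tau (affine_point A B C (1 - u) 0))
    (tau (affine_point A B C 0 0)).
    by have := cost _ _ pN pA h; rewrite edistC; lra.
  by have := cost _ _ pA pN (ltW h); lra.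
have early : tau (affine_point A B C (1 - u) 0) < 1 + y - r.
  by case: (info _ _ pN pC); lra.
by split=> // hag; case: (speed _ _ pN pC hag); lra.
Qed.

End VertexBound.

(** * Two quadratic estimates *)

Section InradiusEstimates.
Variable R : realType.
Local Notation y := (inradius R).

(** By the law of cosines the right side is the squared side opposite an angle of 60 degrees; it is
    at least the height [u * sin 60], and [3 / 2 * y] is this height for [u = 1 / 2]. *)
Lemma height_sqr (u v : R) : 1 / 2 <= u ->
  (3 / 2 * y) ^+ 2 <= u ^+ 2 - u * v + v ^+ 2.
Proof.
move=> hu; have y2 := inradius_sq R; have := sqr_ge0 (v - u / 2).
by have : 0 <= (u - 1 / 2) * (u + 1 / 2) by [apply: mulr_ge0; lra]; lra.
Qed.

(* Eliminating [t] leaves [-y + (1 / 2 + 3 y) v - 5 / 4 v^2 < 0], but this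
   polynomial is concave in [v] and positive at both ends of [y, 1 / 2]. *)
Lemma detour_absurd (t v : R) : y <= v -> v <= 1 / 2 -> 0 <= t ->
  (v - 1 / 2) ^+ 2 + 1 / 12 <= t ^+ 2 -> t < (1 + 2 * y - 3 * v) / 2 -> False.
Proof.
move=> yv v2 t_ge0 ht htv.
have y2 := inradius_sq R; have /andP[ylo yhi] := inradius_bounds R.
have : t ^+ 2 < ((1 + 2 * y - 3 * v) / 2) ^+ 2 by rewrite ltr_pXn2r // nnegrE; lra.
have : 0 <= (v - y) * (1 / 2 - v) by apply: mulr_ge0; lra.
have : 0 <= (v - y) * (7 / 4 * y - 1 / 8) by apply: mulr_ge0; lra.
lra.
Qed.

End InradiusEstimates.

(** * Case analysis with [A] visited late *)

Section OrderedVertices.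
Variables (R : realType) (A B C : 'rV[R]_2) (r T : R).
Variables (tau : 'rV[R]_2 -> R) (ag : 'rV[R]_2 -> bool).
Local Notation y := (inradius R).
Local Notation P := (affine_point A B C).
Hypothesis hABC : equilateral_unit A B C.
Hypothesis r_ge0 : 0 <= r.
Hypothesis sched : schedule A B C r T tau ag.
Hypothesis tauA : 1 + 2 * y <= tau A.
Hypothesis T_lt : T < 1 + 4 * y - r.

Let pAB t : 0 <= t <= 1 -> perimeter A B C (P t 0).
Proof. exact: perimeter_AB. Qed.

Let pBC t : 0 <= t <= 1 -> perimeter A B C (P (1 - t) t).
Proof. exact: perimeter_BC. Qed.

Let pCA t : 0 <= t <= 1 -> perimeter A B C (P 0 t).
Proof. exact: perimeter_CA. Qed.

Let go k a b a' b' := @leg R A B C r T tau ag k a b a' b' hABC sched.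
Let far a b := @start_sqr R A B C r T tau ag a b hABC sched.
Let first p := @inradius_le_start R A B C r T tau ag hABC sched p.

Let pB : perimeter A B C (P 1 0).
Proof. by apply: pAB; lra. Qed.

Let pC : perimeter A B C (P 0 1).
Proof. by apply: pCA; lra. Qed.

Lemma early_BC t : 0 <= t <= 1 -> tau (P (1 - t) t) < 1 + y.
Proof.
move=> ht; have h := opposite_side_early hABC r_ge0 sched tauA T_lt ht.
have := r_ge0; lra.
Qed.

Lemma early_AB u : 0 <= u <= 1 -> u <= tau (P 0 1) - y ->
  tau (P (1 - u) 0) < 1 + y /\
  (ag (P (1 - u) 0) = ag (P 0 1) ->
   tau (P (1 - u) 0) + 3 * y <= tau (P 0 1)).
Proof.
move=> hu huc.
have [h1 h2] := adjacent_side_early hABC r_ge0 sched tauA T_lt hu huc.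
by split=> //; have := r_ge0; lra.
Qed.

Lemma early_CA v : 0 <= v <= 1 -> v <= tau (P 1 0) - y ->
  tau (P 0 (1 - v)) < 1 + y /\
  (ag (P 0 (1 - v)) = ag (P 1 0) ->
   tau (P 0 (1 - v)) + 3 * y <= tau (P 1 0)).
Proof.
rewrite (affine_swap A B C 1 0) (affine_swap A B C 0 (1 - v)) => hv hvb.
have [h1 h2] := adjacent_side_early (equilateral_swap hABC) r_ge0
  (schedule_swap sched) tauA T_lt hv hvb.
by split=> //; have := r_ge0; lra.
Qed.

(** The circumradius is [2 * y], and the remaining window of length [1 - y] is too short to walk
    along a whole side. *)
Lemma two_vertices : [/\ 2 * y <= tau (P 1 0) < 1 + y,
  2 * y <= tau (P 0 1) < 1 + y & ag (P 1 0) <> ag (P 0 1)].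
Proof.
have y2 := inradius_sq R; have /andP[ylo yhi] := inradius_bounds R.
have b_lt : tau (P 1 0) < 1 + y.
  by have := early_BC (t := 0); rewrite subr0; apply; lra.
have c_lt : tau (P 0 1) < 1 + y.
  by have := early_BC (t := 1); rewrite subrr; apply; lra.
have b_ge : 2 * y <= tau (P 1 0).
  by have := far pB; have := first pB; nra.
have c_ge : 2 * y <= tau (P 0 1).
  by have := far pC; have := first pC; nra.
split; [lra | lra |].
by move=> /(go (k := 1) pB pC); case; lra.
Qed.

(** Only the midpoint of a side is as close as [y] to the centroid; this settles the tours below
    that have no time to spare. *)
Lemma start_at_inradius_AB u : 0 <= u <= 1 -> tau (P (1 - u) 0) <= y -> u = 1 / 2.
Proof.
move=> hu h; have pN : perimeter A B C (P (1 - u) 0) by apply: pAB; lra.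
have y2 := inradius_sq R; have d := far pN; have h0 := first pN.
have /andP[ylo _] := inradius_bounds R.
have sq : tau (P (1 - u) 0) ^+ 2 <= y ^+ 2 by rewrite ler_pXn2r // nnegrE; lra.
have : (u - 1 / 2) ^+ 2 <= 0 by lra.
by rewrite exprn_even_le0 //= subr_eq0 => /eqP.
Qed.

Lemma start_at_inradius_BC v : 0 <= v <= 1 -> tau (P (1 - v) v) <= y -> v = 1 / 2.
Proof.
move=> hv h; have pZ := pBC hv.
have y2 := inradius_sq R; have d := far pZ; have h0 := first pZ.
have /andP[ylo _] := inradius_bounds R.
have sq : tau (P (1 - v) v) ^+ 2 <= y ^+ 2 by rewrite ler_pXn2r // nnegrE; lra.
have : (v - 1 / 2) ^+ 2 <= 0 by lra.
by rewrite exprn_even_le0 //= subr_eq0 => /eqP.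
Qed.

(* [B], [C] and the three midpoints are pairwise at distance at least 1/2, so an
   agent visits at most two of these five points before time [1 + y]. *)
Lemma late_vertices_absurd :
  1 / 2 + y <= tau (P 1 0) -> 1 / 2 + y <= tau (P 0 1) -> False.
Proof.
move=> hb hc; have /andP[ylo yhi] := inradius_bounds R.
have [/andP[_ b_lt] /andP[_ c_lt] _] := two_vertices.
have pM : perimeter A B C (P (1 - 1 / 2) (1 / 2)) by apply: pBC; lra.
have pN : perimeter A B C (P (1 - 1 / 2) 0) by apply: pAB; lra.
have pL : perimeter A B C (P 0 (1 - 1 / 2)) by apply: pCA; lra.
have M_lt : tau (P (1 - 1 / 2) (1 / 2)) < 1 + y by apply: early_BC; lra.
have N_lt : tau (P (1 - 1 / 2) 0) < 1 + y by apply: (early_AB _ _).1; lra.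
have L_lt : tau (P 0 (1 - 1 / 2)) < 1 + y by apply: (early_CA _ _).1; lra.
(* Three such visits by one agent take time 1, but the window from [y] to [1 + y] excludes its right
   end. *)
have clash p q s : y <= tau p -> tau p < 1 + y -> y <= tau q -> tau q < 1 + y ->
    y <= tau s -> tau s < 1 + y ->
    (ag p = ag q -> tau p + 1 / 2 <= tau q \/ tau q + 1 / 2 <= tau p) ->
    (ag q = ag s -> tau q + 1 / 2 <= tau s \/ tau s + 1 / 2 <= tau q) ->
    (ag p = ag s -> tau p + 1 / 2 <= tau s \/ tau s + 1 / 2 <= tau p) ->
    ag p = ag q -> ag q = ag s -> False.
  move=> p0 p1 q0 q1 s0 s1 pq qs ps e1 e2; have ps' := ps (etrans e1 e2).
  by case: (pq e1); case: (qs e2); case: ps'; lra.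
have sBC := go (k := 1 / 2) pB pC ltac:(lra).
have sBM := go (k := 1 / 2) pB pM ltac:(lra).
have sBN := go (k := 1 / 2) pB pN ltac:(lra).
have sBL := go (k := 1 / 2) pB pL ltac:(lra).
have sCM := go (k := 1 / 2) pC pM ltac:(lra).
have sCN := go (k := 1 / 2) pC pN ltac:(lra).
have sCL := go (k := 1 / 2) pC pL ltac:(lra).
have sMN := go (k := 1 / 2) pM pN ltac:(lra).
have sML := go (k := 1 / 2) pM pL ltac:(lra).
have sNL := go (k := 1 / 2) pN pL ltac:(lra).
have cBCM := clash _ _ _ (first pB) b_lt (first pC) c_lt
  (first pM) M_lt sBC sCM sBM.
have cBCN := clash _ _ _ (first pB) b_lt (first pC) c_lt
  (first pN) N_lt sBC sCN sBN.
have cBCL := clash _ _ _ (first pB) b_lt (first pC) c_lt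
  (first pL) L_lt sBC sCL sBL.
have cBMN := clash _ _ _ (first pB) b_lt (first pM) M_lt
  (first pN) N_lt sBM sMN sBN.
have cBML := clash _ _ _ (first pB) b_lt (first pM) M_lt
  (first pL) L_lt sBM sML sBL.
have cBNL := clash _ _ _ (first pB) b_lt (first pN) N_lt
  (first pL) L_lt sBN sNL sBL.
have cCMN := clash _ _ _ (first pC) c_lt (first pM) M_lt
  (first pN) N_lt sCM sMN sCN.
have cCML := clash _ _ _ (first pC) c_lt (first pM) M_lt
  (first pL) L_lt sCM sML sCL.
have cCNL := clash _ _ _ (first pC) c_lt (first pN) N_lt
  (first pL) L_lt sCN sNL sCL.
have cMNL := clash _ _ _ (first pM) M_lt (first pN) N_lt
  (first pL) L_lt sMN sNL sML.
move: cBCM cBCN cBCL cBMN cBML cBNL cCMN cCML cCNL cMNL.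
(* Two agents share five points, so one of them visits three. *)
by do 5 case: (ag _); auto.
Qed.

(* With [b = tau B] and [c = tau C], the argument follows the point [N] of [AB] at
   distance [u = c - y] from [B], the point [L] of [CA] at distance [v = b - y]
   from [C], the midpoint [M] of [BC], and a point [Z] of [BC] at distance [u] or
   [v] from [B], all visited before time [1 + y]. *)
Lemma early_vertex_absurd :
  tau (P 1 0) < 1 / 2 + y -> tau (P 1 0) <= tau (P 0 1) -> False.
Proof.
move=> hb hbc; have y2 := inradius_sq R.
have /andP[ylo yhi] := inradius_bounds R.
have [/andP[b_ge b_lt] /andP[c_ge c_lt] agBC] := two_vertices.
have pick p : ag p = ag (P 1 0) \/ ag p = ag (P 0 1).
  by move: agBC; do 3 case: (ag _); auto.
have e_u : exists u, u = tau (P 0 1) - y by eexists.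
have e_v : exists v, v = tau (P 1 0) - y by eexists.
case: e_u e_v => u hu [v hv].
have pN : perimeter A B C (P (1 - u) 0) by apply: pAB; lra.
have pL : perimeter A B C (P 0 (1 - v)) by apply: pCA; lra.
have [N_lt N_C] : tau (P (1 - u) 0) < 1 + y /\
  (ag (P (1 - u) 0) = ag (P 0 1) ->
   tau (P (1 - u) 0) + 3 * y <= tau (P 0 1)) by apply: early_AB; lra.
have [L_lt L_B] : tau (P 0 (1 - v)) < 1 + y /\
  (ag (P 0 (1 - v)) = ag (P 1 0) ->
   tau (P 0 (1 - v)) + 3 * y <= tau (P 1 0)) by apply: early_CA; lra.
have N_ge := first pN; have L_ge := first pL.
have L_ag : ag (P 0 (1 - v)) = ag (P 0 1).
  by case: (pick (P 0 (1 - v))) => // /L_B; lra.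
have L_leg : tau (P 0 (1 - v)) + v <= tau (P 0 1) \/
    tau (P 0 1) + v <= tau (P 0 (1 - v)).
  by apply: (go pL pC) => //; lra.
case: (pick (P (1 - u) 0)) => N_ag; last first.
  (* The agent of [C] would have to visit [N], [L] and [C] in this order. *)
  have {}N_C := N_C N_ag.
  have NL : tau (P (1 - u) 0) + (u - v) <= tau (P 0 (1 - v)) \/
      tau (P 0 (1 - v)) + (u - v) <= tau (P (1 - u) 0).
    apply: (go pN pL); last by rewrite N_ag.
    by have : 0 <= (1 - u) * (1 - v) by [apply: mulr_ge0; lra]; lra.
  case: NL => h1; last lra.
  case: L_leg => h2; last lra.
  (* The tour [N], [L], [C] takes at least [u = tau C - y]. So [N] is the midpoint and [u = 1 / 2],
     too little for the distance [3 * y] from [N] to [C]. *)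
  have N_le : tau (P (1 - u) 0) <= y by lra.
  by have := start_at_inradius_AB _ N_le; lra.
have NB : tau (P 1 0) + u <= tau (P (1 - u) 0).
  case: (go (k := u) pN pB) => //; first by lra.
  move=> h; have [hc|hc] := leP (1 / 2 + y) (tau (P 0 1)); first lra.
  have N_le : tau (P (1 - u) 0) <= y by lra.
  by have := start_at_inradius_AB _ N_le; lra.
have [hc|hc] := leP (1 / 2 + y) (tau (P 0 1)).
  have hu2 : 1 / 2 <= u by lra.
  have pZ : perimeter A B C (P (1 - v) v) by apply: pBC; lra.
  have Z_lt : tau (P (1 - v) v) < 1 + y by apply: early_BC; lra.
  have Z_ge := first pZ.
  case: (pick (P (1 - v) v)) => Z_ag.
    case: (go (k := v) pZ pB _ Z_ag) => [|h|h]; first by lra.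
      have Z_le : tau (P (1 - v) v) <= y by lra.
      by have := start_at_inradius_BC _ Z_le; lra.
    have ZN : ag (P (1 - v) v) = ag (P (1 - u) 0) by rewrite Z_ag.
    case: (go (k := 3 / 2 * y) pZ pN _ ZN) => [|h'|h']; [|lra|lra].
    by have := height_sqr (u := u) v hu2; lra.
  (* By [NB] and the deadline of [N], [u + v < 1], so [Z] cannot precede [C]; the other order
     contradicts [hbc]. *)
  case: (go (k := 1 - v) pZ pC _ Z_ag) => [|h|h]; [lra|lra|lra].
have pM : perimeter A B C (P (1 - 1 / 2) (1 / 2)) by apply: pBC; lra.
have M_lt : tau (P (1 - 1 / 2) (1 / 2)) < 1 + y by apply: early_BC; lra.
have M_ge := first pM.
have pZ : perimeter A B C (P (1 - u) u) by apply: pBC; lra.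
have Z_lt : tau (P (1 - u) u) < 1 + y by apply: early_BC; lra.
have Z_ge := first pZ.
case: (pick (P (1 - 1 / 2) (1 / 2))) => M_ag.
  have MN : ag (P (1 - 1 / 2) (1 / 2)) = ag (P (1 - u) 0) by rewrite M_ag.
  case: (go (k := 1 / 2) pM pB _ M_ag) => [|h|h]; [lra|lra|].
  case: (go (k := 3 / 2 * y) pM pN _ MN) => [|h'|h']; [|lra|lra].
  by have := height_sqr u (lexx (1 / 2)); lra.
have L_early : tau (P 0 (1 - v)) + v <= tau (P 0 1).
  case: L_leg => // h.
  have ML : ag (P (1 - 1 / 2) (1 / 2)) = ag (P 0 (1 - v)) by rewrite M_ag.
  case: (go (k := 1 / 2) pM pC _ M_ag) => [|h1|h1]; [lra|lra|].
  case: (go (k := 3 / 2 * y) pM pL _ ML) => [|h'|h']; [|lra|lra].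
  by have := height_sqr v (lexx (1 / 2)); lra.
case: (pick (P (1 - u) u)) => Z_ag; last first.
  by case: (go (k := 1 - u) pZ pC _ Z_ag) => [|h|h]; [lra|lra|lra].
have ZN : ag (P (1 - u) u) = ag (P (1 - u) 0) by rewrite Z_ag.
have ZB : tau (P 1 0) + u <= tau (P (1 - u) u).
  case: (go (k := u) pZ pB _ Z_ag) => [|h|//]; first by lra.
  have Z_le : tau (P (1 - u) u) <= y by lra.
  by have := start_at_inradius_BC _ Z_le; lra.
(* [B], [N] and [Z] form an equilateral triangle of side [u], and [B] is visited first. *)
have bu : tau (P 1 0) + 2 * u < 1 + y.
  by case: (go (k := u) pZ pN _ ZN) => [|h|h]; [lra|lra|lra].
have L_far := far pL.
(* [L_early] gives [tau L <= u + y - v], and [bu] gives [2 * u < 1 - v]. *)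
by apply: (detour_absurd (t := tau (P 0 (1 - v))) (v := v)); lra.
Qed.

End OrderedVertices.

(** * Choice of the last vertex and conclusion *)

Lemma last_vertex_absurd (R : realType) (A B C : 'rV[R]_2) (r T : R) tau ag :
  equilateral_unit A B C -> 0 <= r -> schedule A B C r T tau ag ->
  tau B <= tau A -> tau C <= tau A -> T < 1 + 4 * inradius R - r -> False.
Proof.
move=> hABC r_ge0 sched hBA hCA hT.
have /andP[ylo yhi] := inradius_bounds R; have y2 := inradius_sq R.
have {}hBA : tau (affine_point A B C 1 0) <= tau (affine_point A B C 0 0).
  by rewrite affine_A affine_B.
have {}hCA : tau (affine_point A B C 0 1) <= tau (affine_point A B C 0 0).
  by rewrite affine_A affine_C.
have pA : perimeter A B C (affine_point A B C 0 0) by apply: perimeter_AB; lra.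
have pB : perimeter A B C (affine_point A B C 1 0) by apply: perimeter_AB; lra.
have pC : perimeter A B C (affine_point A B C 0 1) by apply: perimeter_CA; lra.
have vertex p : perimeter A B C p ->
    (2 * inradius R) ^+ 2 <= tau p ^+ 2 -> 2 * inradius R <= tau p.
  move=> pp; have := inradius_le_start hABC sched pp => h.
  by rewrite ler_pXn2r // nnegrE; lra.
have a_ge := vertex _ pA; have b_ge := vertex _ pB; have c_ge := vertex _ pC.
have farA := start_sqr hABC sched pA; have farB := start_sqr hABC sched pB.
have farC := start_sqr hABC sched pC.
have {}a_ge : 2 * inradius R <= tau (affine_point A B C 0 0) by apply: a_ge; lra.
have {}b_ge : 2 * inradius R <= tau (affine_point A B C 1 0) by apply: b_ge; lra.
have {}c_ge : 2 * inradius R <= tau (affine_point A B C 0 1) by apply: c_ge; lra.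
have legAB := leg (k := 1) hABC sched pA pB ltac:(lra).
have legAC := leg (k := 1) hABC sched pA pC ltac:(lra).
have legBC := leg (k := 1) hABC sched pB pC ltac:(lra).
have tauA : 1 + 2 * inradius R <= tau (affine_point A B C 0 0).
  have [/legAB[]|[/legAC[]|/legBC[]]] :
      ag (affine_point A B C 0 0) = ag (affine_point A B C 1 0) \/
      ag (affine_point A B C 0 0) = ag (affine_point A B C 0 1) \/
      ag (affine_point A B C 1 0) = ag (affine_point A B C 0 1);
    try lra.
  by do 3 case: (ag _); auto.
rewrite affine_A in tauA.
have early D E : equilateral_unit A D E -> schedule A D E r T tau ag ->
    tau D <= tau E -> False.
  move=> hADE schedD hDE.
  have {}hDE : tau (affine_point A D E 1 0) <= tau (affine_point A D E 0 1).
    by rewrite affine_B affine_C.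
  have [h|h] := ltP (tau (affine_point A D E 1 0)) (1 / 2 + inradius R).
    exact: (early_vertex_absurd hADE r_ge0 schedD tauA hT).
  by apply: (late_vertices_absurd hADE r_ge0 schedD tauA hT) => //; lra.
have [h|/ltW h] := leP (tau B) (tau C); first exact: (early B C).
exact: (early C B (equilateral_swap hABC) (schedule_swap sched) h).
Qed.

Lemma vertex_bound (R : realType) (A B C : 'rV[R]_2) (r T : R) tau ag :
  equilateral_unit A B C -> 0 <= r -> schedule A B C r T tau ag ->
  1 + 4 * inradius R - r <= T.
Proof.
move=> hABC r_ge0 sched; rewrite leNgt; apply/negP => hT.
have rotABC := equilateral_rot hABC; have rot_sched := schedule_rot sched.
have [hAB|/ltW hAB] := leP (tau A) (tau B).
- have [hBC|/ltW hBC] := leP (tau B) (tau C).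
  + apply: (last_vertex_absurd (equilateral_rot rotABC) r_ge0
      (schedule_rot rot_sched)) => //; exact: le_trans hBC.
  + exact: (last_vertex_absurd rotABC r_ge0 rot_sched).
- have [hAC|/ltW hAC] := leP (tau A) (tau C).
  + apply: (last_vertex_absurd (equilateral_rot rotABC) r_ge0
      (schedule_rot rot_sched)) => //; exact: le_trans hAC.
  + exact: (last_vertex_absurd hABC r_ge0 sched).
Qed.

Theorem theorem3p3 (R : realType) (A B C : 'rV[R]_2) (r : R)
    (hABC : equilateral_unit A B C) (hr : 0 <= r <= 1)
    (alg : algorithm A B C r) :
  let y : R := Num.sqrt 3 / 6 in
  ((Num.max (3 / 2 + y) (1 + 4 * y - r))%:E <= worst_case_time alg)%E.
Proof.
cbv zeta; rewrite -/(inradius R) leNgt; apply/negP; set D := Num.max _ _ => worst_lt.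
have /andP[r_ge0 _] := hr.
have [T T_lt evac] : exists2 T : R, T < D & forall e, perimeter A B C e ->
    (evacuation_time alg e < T%:E)%E.
  have evac_le e : perimeter A B C e ->
      (evacuation_time alg e <= worst_case_time alg)%E.
    by move=> pe; apply: ereal_sup_ubound; exists e.
  move: worst_lt evac_le; case: (worst_case_time alg) => [w||] //.
    rewrite lte_fin => wD evac_le; exists ((w + D) / 2); first lra.
    by move=> e /evac_le /le_lt_trans; apply; rewrite lte_fin; lra.
  (* This is the formal case of a supremum equal to [-oo]. *)
  move=> _ evac_le; exists (D - 1); first lra.
  by move=> e /evac_le /le_lt_trans; apply; rewrite ltNyr.
have [tau [ag sched]] : exists tau ag, schedule A B C r T tau ag.
  apply: (schedule_of_algorithm (alg := alg) r_ge0) => e /evac.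
  move=> /ereal_inf_lt[_ [t [t_ge0 vis] <-]].
  by rewrite lte_fin => tT; exists t; rewrite // t_ge0 ltW.
move: T_lt; rewrite ltNge ge_max => /negP; apply; apply/andP; split.
  exact: perimeter_bound hABC sched.
exact: vertex_bound hABC r_ge0 sched.
Qed.
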